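(* Let $M\in\mathbb N$ and let $p\ge 3$ be a prime. Let $E\subset\mathfrak G_M^\bot$ be a $(1,M)$-elementary set and let $\hat\varphi\in\mathfrak D_{-1}(\mathfrak G_M^\bot)$ satisfy $|\hat\varphi(\chi)|=\mathbf 1_E(\chi)$ for all $\chi\in X$. Suppose that $\hat\varphi$ is a solution of the equation $$\hat\varphi(\chi)=m_0(\chi)\,\hat\varphi(\chi\mathcal A^{-1}),\qquad \chi\in X,$$ where $m_0$ is a $1$-elementary mask. Then there exists a rooted tree $T(V)$ on the vertex set $V=\{0,1,\dots,p-1\}$ with root $0$ and with $\mathrm{height}(T)=M+2$ that generates the set $E$.
   Context: Let $p$ be a prime. The $p$-adic Vilenkin group $\mathfrak G$ is the set of two-sided sequences $x=(x_k)_{k\in\mathbb Z}$, $x_k\in\{0,\dots,p-1\}$, with only finitely many nonzero $x_k$ with $k<0$, under the operation $\dot+$ of coordinatewise addition modulo $p$. Put $\mathfrak G_n=\{x: x_k=0 \text{ for } k<n\}$, $n\in\mathbb Z$; these subgroups are a base of neighbourhoods of zero, making $\mathfrak G$ a locally compact abelian group. $X$ is the group of (continuous unitary) characters of $\mathfrak G$, written multiplicatively; $(\chi,x)$ is the value of $\chi$ at $x$. $\mathfrak G_n^\bot=\{\chi\in X:(\chi,x)=1\ \forall x\in\mathfrak G_n\}$. The Rademacher characters are $(r_n,x)=\exp(2\pi i x_n/p)$, $n\in\mathbb Z$. The dilation operator $\mathcal A:\mathfrak G\to\mathfrak G$ is $(\mathcal Ax)_n=x_{n+1}$; for $\chi\in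 X$ and $n\in\mathbb Z$, $\chi\mathcal A^n$ is the character $(\chi\mathcal A^n,x)=(\chi,\mathcal A^nx)$ (so $r_k\mathcal A^n=r_{k+n}$), and for $S\subset X$, $S\mathcal A^n=\{\chi\mathcal A^n:\chi\in S\}$. $\mathfrak D_{-N}(\mathfrak G_M^\bot)$ is the set of functions in $L_2(X)$ (Haar measure) that vanish outside $\mathfrak G_M^\bot$ and are constant on each coset of $\mathfrak G_{-N}^\bot$. A set $E\subset X$ is $(N,M)$-elementary if $E$ is a disjoint union of $p^N$ cosets $\mathfrak G_{-N}^\bot\zeta_j$, $\zeta_j=\xi_j\eta_j$, $j=0,\dots,p^N-1$, where $\xi_j=r_{-N}^{\alpha_{-N}}\cdots r_{-1}^{\alpha_{-1}}$ with $j=\alpha_{-N}+\alpha_{-N+1}p+\dots+\alpha_{-1}p^{N-1}$, and $\eta_j=r_0^{\alpha_0}\cdots r_{M-1}^{\alpha_{M-1}}$ for some exponents depending on $j$ (all exponents in $\{0,\dots,p-1\}$), such that: (1) $\bigsqcup_{j}\mathfrak G_{-N}^\bot\xi_j=\mathfrak G_0^\bot$ and $\mathfrak G_{-N}^\bot\xi_0=\mathfrak G_{-N}^\bot$; (2) for every $l=0,\dots,M+N-1$, $(\mathfrak G_{-N+l+1}^\bot\setminus\mathfrak G_{-N+l}^\bot)\cap E\neq\emptyset$. A $1$-elementary mask is a function $m_0:X\to\mathbb C$ that is constant on cosets of $\mathfrak G_{-1}^\bot$, has $|m_0(\chi)|\in\{0,1\}$ for all $\chi$, equals $1$ on $\mathfrak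 G_{-1}^\bot$, and is periodic: $m_0(\chi r_1^{\alpha_1}\cdots r_s^{\alpha_s})=m_0(\chi)$ for all $\chi\in X$, $s\in\mathbb N$, $\alpha_j\in\{0,\dots,p-1\}$. For a tree $T(V)$ on $V=\{0,1,\dots,p-1\}$ rooted at $0$ (edges directed from parent to child), set $$\tilde E=\mathfrak G_{-1}^\bot\ \sqcup\bigsqcup_{(a,b)\text{ edge},\ a\text{ parent of }b}\mathfrak G_{-1}^\bot r_{-1}^{b}r_0^{a},\qquad \tilde E_X=\bigcup_{s\ge1}\ \bigcup_{\alpha_1,\dots,\alpha_s=0}^{p-1}\tilde E\,r_1^{\alpha_1}\cdots r_s^{\alpha_s}.$$ The tree $T(V)$ generates the set $E$ if $E=\bigcap_{n=0}^\infty\tilde E_X\mathcal A^n$. The height of $T$ is the number of vertices in a longest path starting at the root. *)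

(* Defs.v *)
From HB Require Import structures.
From mathcomp Require Import all_boot all_order all_algebra complex.
From mathcomp Require Import all_classical all_reals all_analysis.

Set Implicit Arguments.
Unset Strict Implicit.
Unset Printing Implicit Defensive.

Import Order.TTheory GRing.Theory Num.Theory numFieldNormedType.Exports.
Local Open Scope classical_set_scope.
Local Open Scope ring_scope.
Local Open Scope complex_scope.

(* Digits (and, below, exponents and tree vertices) live in 'F_p, which for
   prime p is the type {0, ..., p-1} with addition modulo p; its elements
   coerce to nat. *)
Record vilenkin (p : nat) := Vilenkin {
  vdigit :> int -> 'F_p;
  vdigit_finite : finite_set [set k : int | k < 0 /\ vdigit k <> 0] }.

Section VilenkinGroup.
Variable p : nat.
Notation VG := (vilenkin p).

Lemma vilenkinP (x y : VG) : (forall k, x k = y k) -> x = y.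
Proof.
case: x y => [x hx] [y hy] /= /funext xy; subst y.
by congr Vilenkin; exact: Prop_irrelevance.
Qed.

Lemma finite_negP (x : int -> 'F_p) :
  finite_set [set k : int | k < 0 /\ x k <> 0] <->
  exists n : int, forall k, k < n -> x k = 0.
Proof.
split.
- move=> /finite_seqP[s hs].
  exists (- (\sum_(i <- s) `|i|) : int) => k hk.
  have sum0 (t : seq int) : 0 <= \sum_(i <- t) `|i| by apply: sumr_ge0.
  apply: contrapT => xk.
  have k0 : k < 0 by apply: lt_le_trans hk _; rewrite oppr_le0 sum0.
  have ks : k \in s by have : [set` s] k by rewrite -hs.
  have : `|k| <= \sum_(i <- s) `|i|.
    by rewrite (perm_big _ (perm_to_rem ks)) big_cons /= lerDl sum0.
  by rewrite ltr0_norm// lerNl leNgt hk.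
- move=> [n hn].
  apply: (@sub_finite_set _ _ ((fun i : nat => - i%:Z) @` `I_(`|n|.+1))); last first.
    exact/finite_image/finite_II.
  move=> k [k0 xk]; exists `|k|%N; last by rewrite abszE ltr0_norm// opprK.
  have nk : n <= k by rewrite leNgt; apply/negP => /hn.
  rewrite /= ltnS -lez_nat !abszE ltr0_norm// ler0_norm ?lerN2//.
  exact: le_trans nk (ltW k0).
Qed.

Lemma vilenkin_bound (x : VG) : exists n : int, forall k, k < n -> x k = 0.
Proof. exact/finite_negP/vdigit_finite. Qed.

HB.instance Definition _ := gen_eqMixin VG.
HB.instance Definition _ := gen_choiceMixin VG.

Fact vzero_finite : finite_set [set k : int | k < 0 /\ (0 : 'F_p) <> 0].
Proof. by apply/(finite_negP (fun=> 0)); exists 0. Qed.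
Definition vzero : VG := Vilenkin vzero_finite.

Fact vopp_finite (x : VG) : finite_set [set k : int | k < 0 /\ - x k <> 0].
Proof.
apply/(finite_negP (fun k => - x k)).
by have [n xn] := vilenkin_bound x; exists n => k /xn ->; rewrite oppr0.
Qed.
Definition vopp (x : VG) : VG := Vilenkin (vopp_finite x).

Fact vadd_finite (x y : VG) :
  finite_set [set k : int | k < 0 /\ x k + y k <> 0].
Proof.
apply/(finite_negP (fun k => x k + y k)).
have [n xn] := vilenkin_bound x; have [m ym] := vilenkin_bound y.
by exists (Num.min n m) => k; rewrite lt_min => /andP[/xn -> /ym ->]; rewrite addr0.
Qed.
Definition vadd (x y : VG) : VG := Vilenkin (vadd_finite x y).

Fact vaddA : associative vadd.
Proof. by move=> x y z; apply: vilenkinP => k /=; rewrite addrA. Qed.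
Fact vaddC : commutative vadd.
Proof. by move=> x y; apply: vilenkinP => k /=; rewrite addrC. Qed.
Fact vadd0 : left_id vzero vadd.
Proof. by move=> x; apply: vilenkinP => k /=; rewrite add0r. Qed.
Fact vaddN : left_inverse vzero vopp vadd.
Proof. by move=> x; apply: vilenkinP => k /=; rewrite addNr. Qed.

HB.instance Definition _ := GRing.isZmodule.Build VG vaddA vaddC vadd0 vaddN.

Definition vsubgroup (n : int) : set VG :=
  [set x | forall k, k < n -> x k = 0].

Definition vnbhs (x : VG) : set_system VG :=
  filter_from [set: int] (fun n => [set y | vsubgroup n (y - x)]).

HB.instance Definition _ := hasNbhs.Build VG vnbhs.

Fact vnbhs_filter (x : VG) : ProperFilter (nbhs x).
Proof.
apply: filter_from_proper; last first.
  by move=> n _; exists x => /= k _; rewrite subrr.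
apply: filter_from_filter; first by exists 0.
move=> m n _ _; exists (Num.max m n) => // y /= h.
by split => k hk; apply: h; rewrite lt_max hk ?orbT.
Qed.

Fact vnbhs_singleton (x : VG) (A : set VG) : nbhs x A -> A x.
Proof. by move=> [n _]; apply => k _; rewrite subrr. Qed.

Fact vnbhs_nbhs (x : VG) (A : set VG) : nbhs x A -> nbhs x (nbhs^~ A).
Proof.
move=> [n _ h]; exists n => // y /= hy; exists n => // z /= hz.
apply: h => k kn; have -> : z - x = (z - y) + (y - x) by rewrite addrA subrK.
by rewrite -[LHS]/((z - y) k + (y - x) k) hz// hy// addr0.
Qed.

HB.instance Definition _ :=
  Nbhs_isNbhsTopological.Build VG vnbhs_filter vnbhs_singleton vnbhs_nbhs.

Fact dilation_finite (m : int) (x : VG) :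
  finite_set [set k : int | k < 0 /\ x (k + m) <> 0].
Proof.
apply/(finite_negP (fun k => x (k + m))).
have [n xn] := vilenkin_bound x.
by exists (n - m) => k; rewrite ltrBrDr => /xn.
Qed.

(* [dilation m] is the m-th power (m of any sign) of the dilation operator
   [dilation 1], which shifts the digits by one. *)
Definition dilation (m : int) (x : VG) : VG := Vilenkin (dilation_finite m x).

Lemma dilation0 : dilation 0 = id.
Proof. by apply/funext => x; apply: vilenkinP => k /=; rewrite addr0. Qed.

Lemma dilationD m n : dilation (m + n) = dilation m \o dilation n.
Proof. by apply/funext => x; apply: vilenkinP => k /=; rewrite addrA. Qed.

Lemma dilation_additive m : {morph dilation m : x y / x + y}.
Proof. by move=> x y; apply: vilenkinP. Qed.

Lemma dilation_continuous m : continuous (dilation m).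
Proof.
move=> x A [n _ hA]; exists (n + m) => // y /= hy.
by apply: hA => k kn /=; apply: (hy (k + m)); rewrite ltrD2r.
Qed.

End VilenkinGroup.

Record character (R : realType) (p : nat) := Character {
  char_fun :> vilenkin p -> R[i];
  charM : forall x y, char_fun (x + y) = char_fun x * char_fun y;
  char_norm : forall x, `|char_fun x| = 1;
  char_continuous : continuous (char_fun : vilenkin p -> (R[i])^o) }.

Section CharacterGroup.
Variables (R : realType) (p : nat).
Notation X := (character R p).

Lemma characterP (f g : X) : (forall x, f x = g x) -> f = g.
Proof.
case: f g => [f h1 h2 h3] [g k1 k2 k3] /= /funext fg; subst g.
by congr Character; exact: Prop_irrelevance.
Qed.

Lemma char_neq0 (f : X) x : f x != 0.
Proof. by rewrite -normr_eq0 char_norm oner_eq0. Qed.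

HB.instance Definition _ := gen_eqMixin X.
HB.instance Definition _ := gen_choiceMixin X.

Fact char_one_continuous : continuous ((fun=> 1) : vilenkin p -> (R[i])^o).
Proof. exact: cst_continuous. Qed.

Definition char_one : X :=
  @Character R p (fun=> 1) (fun _ _ => esym (mulr1 1)) (fun _ => @normr1 _)
    char_one_continuous.

Section Mul.
Variables f g : X.
Fact char_mulM x y : f (x + y) * g (x + y) = (f x * g x) * (f y * g y).
Proof. by rewrite !charM mulrACA. Qed.
Fact char_mul_norm x : `|f x * g x| = 1.
Proof. by rewrite normrM !char_norm mulr1. Qed.
Fact char_mul_continuous :
  continuous ((fun x => f x * g x) : vilenkin p -> (R[i])^o).
Proof.
move=> x; apply: (@continuousM R[i] _ (f : _ -> (R[i])^o) (g : _ -> (R[i])^o));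
  exact: char_continuous.
Qed.
Definition char_mul : X := Character char_mulM char_mul_norm char_mul_continuous.

Fact char_invM x y : (f (x + y))^-1 = (f x)^-1 * (f y)^-1.
Proof. by rewrite charM invfM. Qed.
Fact char_inv_norm x : `|(f x)^-1| = 1.
Proof. by rewrite normfV char_norm invr1. Qed.
Fact char_inv_continuous :
  continuous ((fun x => (f x)^-1) : vilenkin p -> (R[i])^o).
Proof.
move=> x; apply: (@continuousV R[i] _ (f : _ -> (R[i])^o)).
  exact: char_neq0.
exact: char_continuous.
Qed.
Definition char_inv : X := Character char_invM char_inv_norm char_inv_continuous.
End Mul.

Fact char_mulA : associative char_mul.
Proof. by move=> f g h; apply: characterP => x /=; rewrite mulrA. Qed.
Fact char_mul1g : left_id char_one char_mul.
Proof. by move=> f; apply: characterP => x /=; rewrite mul1r. Qed.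
Fact char_mulg1 : right_id char_one char_mul.
Proof. by move=> f; apply: characterP => x /=; rewrite mulr1. Qed.
Fact char_mulVg : left_inverse char_one char_inv char_mul.
Proof. by move=> f; apply: characterP => x /=; rewrite mulVf// char_neq0. Qed.
Fact char_mulgV : right_inverse char_one char_inv char_mul.
Proof. by move=> f; apply: characterP => x /=; rewrite mulfV// char_neq0. Qed.

HB.instance Definition _ :=
  isGroup.Build X char_mulA char_mul1g char_mulg1 char_mulVg char_mulgV.
HB.instance Definition _ := isPointed.Build X char_one.

Section Dilate.
Variables (f : X) (m : int).
Fact char_dilM x y :
  f (dilation m (x + y)) = f (dilation m x) * f (dilation m y).
Proof. by rewrite dilation_additive charM. Qed.
Fact char_dil_norm x : `|f (dilation m x)| = 1.
Proof. exact: char_norm. Qed.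
Fact char_dil_continuous :
  continuous ((fun x => f (dilation m x)) : vilenkin p -> (R[i])^o).
Proof.
move=> x; apply: (@continuous_comp _ _ _ (@dilation p m) (f : _ -> (R[i])^o)).
  exact: dilation_continuous.
exact: char_continuous.
Qed.
(* chi A^m *)
Definition char_dil : X := Character char_dilM char_dil_norm char_dil_continuous.
End Dilate.

Definition annihilator (n : int) : set X :=
  [set chi | forall x, vsubgroup n x -> chi x = 1].

Definition annih_coset (n : int) (zeta : X) : set X :=
  [set (chi * zeta)%g | chi in annihilator n].

(* The cosets of the annihilators form a countable base of the topology of the
   dual group, so that the sigma-algebra they generate is the Borel one. *)
Definition annih_cosets : set_system X :=
  [set A | exists n zeta, A = annih_coset n zeta].

Definition haar_measure
    (mu : {measure set (g_sigma_algebraType annih_cosets) -> \bar R}) : Prop :=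
  (0 < mu (annihilator 0) < +oo)%E /\
  forall (zeta : X) (A : set (g_sigma_algebraType annih_cosets)),
    measurable A -> mu [set (chi * zeta)%g | chi in (A : set X)] = mu A.

(* Haar measure is unique up to a positive factor, so quantifying over all Haar
   measures is the same as choosing one. *)
Definition in_L2 (f : X -> R[i]) : Prop :=
  forall mu : {measure set (g_sigma_algebraType annih_cosets) -> \bar R},
    haar_measure mu ->
    [/\ measurable_fun [set: g_sigma_algebraType annih_cosets]
          (fun chi => complex.Re (f chi)),
        measurable_fun [set: g_sigma_algebraType annih_cosets]
          (fun chi => complex.Im (f chi)) &
        (\int[mu]_chi
          (complex.Re (f chi) ^+ 2 + complex.Im (f chi) ^+ 2)%:E < +oo)%E].

Definition constant_on_cosets (n : int) (f : X -> R[i]) : Prop :=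
  forall zeta chi, annih_coset n zeta chi -> f chi = f zeta.

(* D_{-N}(G_M^\bot) *)
Definition step_space (N M : nat) : set (X -> R[i]) :=
  [set f | [/\ in_L2 f,
               forall chi, ~ annihilator M%:Z chi -> f chi = 0 &
               constant_on_cosets (- N%:Z) f]].

End CharacterGroup.

Section Rademacher.
Variables (R : realType).

(* exp (i t) *)
Definition expi (t : R) : R[i] := cos t +i* sin t.

Lemma expiD s t : expi (s + t) = expi s * expi t.
Proof.
rewrite /expi cosD sinD; apply/eqP; rewrite eq_complex /= eqxx /=.
by rewrite addrC [sin s * _]mulrC [cos t * _]mulrC addrC mulrC.
Qed.

Lemma norm_expi t : `|expi t| = 1.
Proof. by rewrite normc_def /= cos2Dsin2 sqrtr1. Qed.

Lemma expi_period (k : nat) : expi (2 * pi * k%:R) = 1.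
Proof.
have e1 : expi (2 * pi) = 1 by rewrite mulrC mulr_natr /expi cos2pi sin2pi.
elim: k => [|k IH]; first by rewrite mulr0 /expi cos0 sin0.
by rewrite -[k.+1%:R]natr1 mulrDr mulr1 expiD IH e1 mulr1.
Qed.

Variables (p : nat) (p_pr : prime p).
Notation X := (character R p).

Definition rademacher_fun (n : int) (x : vilenkin p) : R[i] :=
  expi (2 * pi * (x n : nat)%:R / p%:R).

Fact rademacherM n (x y : vilenkin p) :
  rademacher_fun n (x + y) = rademacher_fun n x * rademacher_fun n y.
Proof.
rewrite /rademacher_fun -expiD -mulrDl -mulrDr -natrD.
have p0 : p%:R != 0 :> R by rewrite pnatr_eq0 -lt0n prime_gt0.
have -> : (vdigit (x + y) n : nat) = ((x n + y n) %% p)%N.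
  by rewrite -(congr1 (modn _) (Fp_cast p_pr)).
set u : nat := x n; set v : nat := y n.
rewrite [in RHS](divn_eq (u + v) p) [in RHS]natrD natrM.
rewrite [in RHS]mulrDr [in RHS]mulrDl expiD.
by rewrite [2 * pi * (_ * _)]mulrA mulfK// expi_period mul1r.
Qed.

Fact rademacher_norm n x : `|rademacher_fun n x| = 1.
Proof. exact: norm_expi. Qed.

Fact rademacher_continuous n :
  continuous (rademacher_fun n : vilenkin p -> (R[i])^o).
Proof.
move=> x A /nbhs_singleton Ax; exists (n + 1) => // y /= hy.
rewrite /rademacher_fun; suff -> : y n = x n by [].
by apply/eqP; rewrite -subr_eq0; apply/eqP/hy; rewrite ltrDl.
Qed.

Definition rademacher (n : int) : X :=
  Character (@rademacherM n) (@rademacher_norm n) (@rademacher_continuous n).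

Local Open Scope group_scope.

(* r_{-N}^{a_{-N}} ... r_{-1}^{a_{-1}}, the a_i being the base p digits of j,
   least significant first *)
Definition xi (N j : nat) : X :=
  \prod_(i < N) rademacher (i%:Z - N%:Z)%R ^+ ((j %/ p ^ i) %% p)%N.

Definition eta (M : nat) (a : nat -> 'F_p) : X :=
  \prod_(i < M) rademacher i%:Z ^+ a i.

Definition elementary (N M : nat) (E : set X) : Prop :=
  exists a : nat -> nat -> 'F_p,
    let zeta j := xi N j * eta M (a j) in
    [/\ trivIset `I_(p ^ N) (fun j => annih_coset (- N%:Z)%R (zeta j)) /\
        E = \bigcup_(j < p ^ N) annih_coset (- N%:Z)%R (zeta j),
        trivIset `I_(p ^ N) (fun j => annih_coset (- N%:Z)%R (xi N j)) /\
        \bigcup_(j < p ^ N) annih_coset (- N%:Z)%R (xi N j) = annihilator 0,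
        annih_coset (- N%:Z)%R (xi N 0) = annihilator (- N%:Z)%R &
        forall l : nat, (l < M + N)%N ->
          (annihilator (l%:Z + 1 - N%:Z)%R `\` annihilator (l%:Z - N%:Z)%R)
            `&` E !=set0].

(* r_1^{a_1} ... r_s^{a_s} *)
Definition pos_shift (s : nat) (a : nat -> 'F_p) : X :=
  \prod_(1 <= i < s.+1) rademacher i%:Z ^+ a i.

Definition one_elementary_mask (m0 : X -> R[i]) : Prop :=
  [/\ constant_on_cosets (-1) m0,
      forall chi, `|m0 chi|%R = 0%R \/ `|m0 chi|%R = 1%R,
      forall chi, annihilator (-1) chi -> m0 chi = 1%R &
      forall chi s a, m0 (chi * pos_shift s a) = m0 chi].

(* Trees on V = 'F_p, given by the relation T a b "a is the parent of b": a tree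
   rooted at 0 with edges directed away from the root is a digraph in which
   each vertex is the end of exactly one directed walk from 0 (for the vertex 0
   this is the empty walk, so that no edge enters 0). *)
Definition rooted_tree (T : rel 'F_p) : Prop :=
  forall v, exists! s : seq 'F_p, path T 0%R s /\ last 0%R s = v.

(* The vertices of the path are 0 :: s. *)
Definition has_height (T : rel 'F_p) (h : nat) : Prop :=
  (exists s, path T 0%R s /\ size (0%R :: s) = h) /\
  (forall s, path T 0%R s -> (size (0%R :: s) <= h)%N).

Definition tree_set (T : rel 'F_p) : set X :=
  annihilator (-1) `|`
  \bigcup_(ab in [set ab : 'F_p * 'F_p | T ab.1 ab.2])
    annih_coset (-1) (rademacher (-1) ^+ ab.2 * rademacher 0 ^+ ab.1).

Definition tree_set_periodic (T : rel 'F_p) : set X :=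
  \bigcup_(s in [set s : nat | (1 <= s)%N]) \bigcup_(a in [set: nat -> 'F_p])
    [set chi * pos_shift s a | chi in tree_set T].

Definition tree_generates (T : rel 'F_p) (E : set X) : Prop :=
  E = \bigcap_(n in [set: nat])
        [set char_dil chi n%:Z | chi in tree_set_periodic T].

End Rademacher.

(* Main.v *)
Require Import Defs.
From mathcomp Require Import all_boot all_order all_algebra complex.
From mathcomp Require Import all_classical all_reals all_analysis.
From mathcomp Require Import zify lra.

Import Order.TTheory GRing.Theory Num.Theory numFieldNormedType.Exports.
Local Open Scope classical_set_scope.
Local Open Scope ring_scope.
Local Open Scope complex_scope.

(** Every character [chi] has digits [c k] in ['F_p], given by
    [chi (e_k) = omega ^+ c k], where [e_k] is the sequence with a single 1, at
    index [k], and [omega = exp (2 i pi / p)]. Digits add up under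
    multiplication of characters, dilation shifts them, and since the unit
    circle has no small subgroups a character lies in [annihilator n] exactly
    when its digits from index [n] on vanish ([annihilatorP]). So the cosets of
    [annihilator (-1)] are the finitely supported words
    [c (-1), c 0, c 1, ...], and everything becomes combinatorics of words.

    In these terms an elementary set with [N = 1] consists of [p] words, one for
    each first letter ([elementary_section]). If [chi] is in [E], then
    [phi chi <> 0], hence [phi (chi A^-1) <> 0] by the refinement equation, so
    that [chi A^-1] is in [E]: the set of words is closed under dropping the
    first letter. A word of [E] being determined by its first letter, the second
    letter is a function [f] of the first, and the word that starts with [d] is
    [d, f d, f (f d), ...]. As [E] is included in [annihilator M],
    [f^(M+1) d = 0] for all [d], whence [f 0 = 0].

    Taking [f b] as the parent of each [b <> 0] therefore gives a tree rooted at
    [0] ([parent_rooted_tree]); it has height [M + 2] because the condition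
    on the last layer [annihilator M `\` annihilator (M - 1)] supplies a [d] with
    [f^M d <> 0] ([parent_has_height]). Finally, the set that this tree
    generates is cut out by the equations [c n = f (c (n - 1))] for [n >= 0]
    ([tree_limitP]), and these describe exactly the words of [E]. *)

(** * Trees given by a parent function *)

Section ParentTree.
Set Implicit Arguments. Unset Strict Implicit.
Variables (V : eqType) (r : V) (f : V -> V).

Definition parent_rel : rel V := fun a b => (b != r) && (f b == a).

(** Walking down a path and climbing back with [f] retrace the same vertices, and
    no edge enters the root; this makes the length of a path from the root the
    exact depth of its end. *)
Lemma parent_path_neq_root s k :
  path parent_rel r s -> (k < size s)%N -> iter k f (last r s) != r.
Proof.
elim/last_ind: s k => [//|s v IH] k.
rewrite rcons_path last_rcons size_rcons => /andP[ps /andP[vr /eqP fv]].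
case: k => [//|k]; rewrite ltnS iterSr fv; exact: IH.
Qed.

Lemma parent_path_root s : path parent_rel r s -> iter (size s) f (last r s) = r.
Proof.
elim/last_ind: s => [//|s v IH].
rewrite rcons_path last_rcons size_rcons => /andP[ps /andP[_ /eqP fv]].
by rewrite iterSr fv IH.
Qed.

Lemma parent_path_uniq s t : path parent_rel r s -> path parent_rel r t ->
  last r s = last r t -> s = t.
Proof.
elim/last_ind: s t => [|s v IH] t; case/lastP: t => [//|t w].
- rewrite rcons_path last_rcons => _ /andP[_ /andP[/[swap] _ /eqP wr]] /= rw.
  by case: wr.
- rewrite rcons_path last_rcons => /andP[_ /andP[/[swap] _ /eqP vr]] _ /= rv.
  by case: vr.
rewrite !rcons_path !last_rcons => /andP[ps /andP[_ /eqP fv]].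
move=> /andP[pt /andP[_ /eqP fw]] vw; rewrite -vw in fw *.
by rewrite (IH t)// -fv -fw.
Qed.

Lemma parent_path_ex n v : iter n f v = r ->
  exists2 s, path parent_rel r s & last r s = v.
Proof.
elim: n v => [|n IH] v; first by move=> /= ->; exists [::].
have [-> _|vr] := eqVneq v r; first by exists [::].
rewrite iterSr => /IH[s ps sv]; exists (rcons s v); last by rewrite last_rcons.
by rewrite rcons_path ps /= sv /parent_rel vr eqxx.
Qed.

Lemma iter_root n v : f r = r -> iter n f v = r ->
  forall m, (n <= m)%N -> iter m f v = r.
Proof.
move=> fr nv m /subnK <-; rewrite iterD nv; elim: (m - n)%N => //= k ->.
exact: fr.
Qed.

End ParentTree.

Section FpTree.
Variables (p : nat) (f : 'F_p -> 'F_p) (n : nat).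
Hypotheses (f0 : f 0 = 0) (fn : forall v, iter n f v = 0).

(** The ancestors of [v] are the iterates of [f] at [v], so a walk from the root
    to [v] is forced, and it exists because these iterates reach the root. *)
Lemma parent_rooted_tree : rooted_tree (parent_rel 0 f).
Proof.
move=> v; have [s ps sv] := parent_path_ex (fn v).
by exists s; split=> // t [pt tv]; apply: (parent_path_uniq ps pt); rewrite sv.
Qed.

(** The hypothesis says that some vertex has the largest depth that [fn]
    permits; the height counts vertices, hence one more than this depth. *)
Lemma parent_has_height v : iter n.-1 f v != 0 ->
  has_height (parent_rel 0 f) n.+1.
Proof.
move=> v0; split; last first.
  move=> s ps; rewrite /= ltnS leqNgt; apply/negP => /(parent_path_neq_root ps).
  by rewrite fn eqxx.
have [s ps sv] := parent_path_ex (fn v); exists s; split=> //=; congr S.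
apply/eqP; rewrite eqn_leq; apply/andP; split; rewrite leqNgt; apply/negP.
  by move=> /(parent_path_neq_root ps); rewrite fn eqxx.
move=> sn; move: v0; rewrite -sv (iter_root f0 (parent_path_root ps)) ?eqxx//.
by case: (n) sn.
Qed.
End FpTree.

(** * The p-th roots of unity *)

Section RootsOfUnity.
Set Implicit Arguments. Unset Strict Implicit.
Variables (R : realType) (p : nat) (p_pr : prime p).

Definition omega : R[i] := expi (2 * pi / p%:R).

Lemma expi_omega (a : nat) : expi (2 * pi * a%:R / p%:R) = omega ^+ a.
Proof.
elim: a => [|a IH]; first by rewrite mulr0 mul0r expr0 /expi cos0 sin0.
by rewrite -[a.+1%:R]natr1 mulrDr mulr1 mulrDl expiD IH exprSr.
Qed.

Lemma omega_neq1 : omega != 1.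
Proof.
have p1 := prime_gt1 p_pr; have p0 : 0 < p%:R :> R by rewrite ltr0n prime_gt0.
apply/eqP => /(congr1 (@complex.Re R)) /=.
(* The double angle formula reduces the claim to the positivity of
   [sin (pi / p)], which holds for [p = 2] as well. *)
have -> : 2 * pi / p%:R = (pi / p%:R) *+ 2 :> R by rewrite -mulrA mulr_natl.
rewrite cos_mulr2n cos2sin2 => h.
have s0 : 0 < sin (pi / p%:R : R).
  apply: sin_gt0_pi; rewrite divr_gt0 ?pi_gt0//= ltr_pdivrMr//.
  by rewrite ltr_pMr ?pi_gt0// ltr1n.
have s2 : 0 < sin (pi / p%:R : R) ^+ 2 by rewrite exprn_gt0.
by move: s2; lra.
Qed.

Lemma omega_prim : p.-primitive_root omega.
Proof.
have op : omega ^+ p = 1.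
  rewrite -expi_omega mulfK ?pnatr_eq0 -?lt0n ?prime_gt0//.
  by have h := expi_period R 1; rewrite mulr1n mulr1 in h. 
have [m pm mp] := prim_order_exists (prime_gt0 p_pr) op.
have /primeP[_ /(_ _ mp)/orP[/eqP m1|/eqP <-//]] := p_pr.
by move: pm; rewrite m1 => /prim_expr_order; rewrite expr1 => /eqP; rewrite (negPf omega_neq1).
Qed.

Lemma Fp_ltp (a : 'F_p) : (a < p)%N.
Proof. by rewrite -{2}(Fp_cast p_pr). Qed.

Lemma omega_Fp_inj (a b : 'F_p) : omega ^+ a = omega ^+ b -> a = b.
Proof.
move=> /eqP; rewrite (eq_prim_root_expr omega_prim) !modn_small ?Fp_ltp//.
by move=> /eqP /val_inj.
Qed.

Lemma omega_Fp_surj z : z ^+ p = 1 -> exists a : 'F_p, z = omega ^+ a.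
Proof.
move=> /(prim_rootP omega_prim)[i ->]; exists (inord i).
by rewrite inordK // Fp_cast.
Qed.

Lemma omega_FpD (a b : 'F_p) : omega ^+ (a + b)%R = omega ^+ a * omega ^+ b.
Proof.
have -> : ((a + b)%R : nat) = ((a + b) %% p)%N.
  by rewrite -(congr1 (modn _) (Fp_cast p_pr)).
by rewrite (prim_expr_mod omega_prim) exprD.
Qed.

(** The circle has no small subgroups among those of exponent [p]; this is what
    makes continuous characters trivial on some [vsubgroup n]. *)
Lemma near1_unity_root :
  nbhs (1 : R[i]^o) [set z : R[i]^o | z ^+ p = 1 -> z = 1].
Proof.
pose A : set R[i]^o := [set omega ^+ (a : 'F_p) | a in [set a : 'F_p | a != 0]].
have cA : closed A.
  apply: (accessible_finite_set_closed.1 _ A).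
    exact/hausdorff_accessible/norm_hausdorff.
  exact: finite_image.
have : open_nbhs (1 : R[i]^o) (~` A).
  split; first exact: closed_openC.
  move=> [a a0]; rewrite -(expr0 omega) => /(omega_Fp_inj (b := 0)) => ha.
  by move: a0; rewrite /= ha eqxx.
move=> /open_nbhs_nbhs; apply: filterS => z nAz /omega_Fp_surj[a za].
have [a0|a0] := eqVneq a 0; first by rewrite za a0 expr0.
by case: nAz; exists a.
Qed.
End RootsOfUnity.

(** * Digits of characters *)

Section DualDigits.
Set Implicit Arguments. Unset Strict Implicit.
Variables (R : realType) (p : nat) (p_pr : prime p).
Notation X := (character R p).
Notation w := (omega R p).

Fact vbasis_finite (k : int) : finite_set
  [set i : int | i < 0 /\ (if i == k then 1 else 0 : 'F_p) <> 0].
Proof.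
apply/(finite_negP (fun i => if i == k then 1 else 0 : 'F_p)).
by exists k => i ik; rewrite lt_eqF.
Qed.
Definition vbasis k : vilenkin p := Vilenkin (vbasis_finite k).

Lemma vdigitMn (x : vilenkin p) n k : (x *+ n) k = x k *+ n.
Proof. by elim: n => [|n IH]; rewrite ?mulr0n// !mulrS -IH. Qed.

Lemma Fp_mulrn (a : 'F_p) : a *+ p = 0.
Proof. by rewrite -mulr_natr pchar_Fp_0 ?mulr0. Qed.

Lemma char0 (chi : X) : chi 0 = 1.
Proof.
by apply: (mulfI (char_neq0 chi 0)); rewrite -charM addr0 mulr1.
Qed.

Lemma charMn (chi : X) x n : chi (x *+ n) = chi x ^+ n.
Proof. by elim: n => [|n IH]; rewrite ?char0// mulrS charM IH exprS. Qed.

Lemma char_unity_root (chi : X) x : chi x ^+ p = 1.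
Proof.
rewrite -charMn (_ : x *+ p = 0) ?char0//.
by apply: vilenkinP => k; rewrite vdigitMn Fp_mulrn.
Qed.

Definition dual_digit (chi : X) (k : int) : 'F_p :=
  xget 0 [set a : 'F_p | chi (vbasis k) = w ^+ a].

Lemma dual_digitE (chi : X) k : chi (vbasis k) = w ^+ dual_digit chi k.
Proof.
have := omega_Fp_surj p_pr (char_unity_root chi (vbasis k)).
exact: (@xgetPex _ 0 [set a : 'F_p | chi (vbasis k) = w ^+ a]).
Qed.

Lemma dual_digit_eq (chi : X) k (a : 'F_p) : chi (vbasis k) = w ^+ a -> dual_digit chi k = a.
Proof. by rewrite dual_digitE => /(omega_Fp_inj p_pr). Qed.

Lemma dual_digitM (chi psi : X) k :
  dual_digit (chi * psi)%g k = dual_digit chi k + dual_digit psi k.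
Proof. by apply: dual_digit_eq; rewrite (omega_FpD R p_pr) -!dual_digitE. Qed.

Lemma dual_digit1 k : dual_digit 1%g k = 0.
Proof. exact: dual_digit_eq. Qed.

Lemma dual_digitV (chi : X) k : dual_digit (chi^-1)%g k = - dual_digit chi k.
Proof.
by apply/eqP; rewrite -addr_eq0 -dual_digitM mulVg dual_digit1.
Qed.

Lemma dual_digitX (chi : X) n k : dual_digit (chi ^+ n)%g k = dual_digit chi k *+ n.
Proof.
by elim: n => [|n IH]; rewrite ?dual_digit1// expgS mulrS dual_digitM IH.
Qed.

Lemma dual_digit_prod I (s : seq I) (P : pred I) (F : I -> X) k :
  dual_digit (\prod_(i <- s | P i) F i)%g k = \sum_(i <- s | P i) dual_digit (F i) k.
Proof.
by apply: (big_morph (fun chi : X => dual_digit chi k)) => [chi psi|];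
  rewrite ?dual_digitM ?dual_digit1.
Qed.

Lemma dual_digit_rademacherX n (a : 'F_p) k :
  dual_digit (rademacher R p_pr n ^+ a)%g k = if k == n then a else 0.
Proof.
rewrite dual_digitX; suff -> : dual_digit (rademacher R p_pr n) k = if n == k then 1 else 0.
  by rewrite eq_sym; case: eqP => _; rewrite ?mul0rn// natr_Zp.
by apply: dual_digit_eq; rewrite -expi_omega.
Qed.

Lemma dual_digit_dil (chi : X) m k :
  dual_digit (char_dil chi m) k = dual_digit chi (k - m).
Proof.
apply: dual_digit_eq; rewrite -dual_digitE /=; congr (chi _).
by apply: vilenkinP => i /=; rewrite -subr_eq opprK.
Qed.

(** Subtracting [x n] copies of [e_n] moves an element of [vsubgroup n] into
    [vsubgroup (n + 1)]. *)
Lemma annihilator_step (chi : X) n :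
  annihilator (n + 1) chi -> dual_digit chi n = 0 -> annihilator n chi.
Proof.
move=> h n0 x hx; rewrite -(subrK (vbasis n *+ x n) x) charM charMn.
rewrite dual_digitE n0 expr0 expr1n mulr1; apply: h => k kn.
rewrite -[LHS]/(x k - (vbasis n *+ x n) k) vdigitMn /=.
have [->|nk] := eqVneq k n; first by rewrite natr_Zp subrr.
by rewrite mul0rn subr0 hx// lt_neqAle nk -ltzD1.
Qed.

Lemma annihilator_bound (chi : X) : exists n, annihilator n chi.
Proof.
have h : nbhs (chi 0 : R[i]^o) [set z : R[i]^o | z ^+ p = 1 -> z = 1].
  by rewrite char0; exact: near1_unity_root.
have [n _ hn] := char_continuous h.
exists n => x nx; apply: (hn x); last exact: char_unity_root.
by rewrite /= subr0.
Qed.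

(** By continuity [chi] is trivial on some [vsubgroup m]; from there the digits
    control the values on larger subgroups, one index at a time. *)
Lemma annihilatorP (chi : X) n :
  annihilator n chi <-> (forall k : int, n <= k -> dual_digit chi k = 0).
Proof.
split=> [h k nk|h].
  apply: dual_digit_eq; rewrite expr0; apply: h => i ik /=.
  by rewrite lt_eqF// (lt_le_trans ik).
have [m hm] := annihilator_bound chi.
have [mn|nm] := leP m n; first by move=> x hx; apply: hm => k km; apply/hx/(lt_le_trans km).
have [d md] : exists d : nat, m = n + d%:Z.
  by exists `|m - n|%N; rewrite gez0_abs ?subr_ge0 ?(ltW nm)// addrCA subrr addr0.
rewrite {}md {nm m} in hm; elim: d hm => [|d IH]; first by rewrite addr0.
rewrite -addn1 PoszD addrA => /annihilator_step hd; apply/IH/hd/h.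
by rewrite lerDl.
Qed.

Lemma annih_cosetP (chi zeta : X) n : annih_coset n zeta chi <->
  (forall k : int, n <= k -> dual_digit chi k = dual_digit zeta k).
Proof.
split=> [[th /annihilatorP h <-] k nk|h]; first by rewrite dual_digitM h// add0r.
exists (chi * zeta^-1)%g; last by rewrite -mulgA mulVg mulg1.
by apply/annihilatorP => k nk; rewrite dual_digitM dual_digitV h// subrr.
Qed.

Lemma dual_digit_pos_shift s a k :
  dual_digit (pos_shift R p_pr s a) k =
  if (1 <= k <= s%:Z) then a `|k|%N else 0.
Proof.
rewrite dual_digit_prod.
under eq_bigr do rewrite dual_digit_rademacherX.
case: k => [k|k]; last by rewrite /= big1.
rewrite lez_nat [1 <= _]lez_nat absz_nat; under eq_bigr do rewrite eqz_nat.
rewrite -big_mkcond /= (eq_bigl (fun i => i == k)); last by move=> i; rewrite eq_sym.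
by rewrite big_nat1_eq.
Qed.

Lemma dual_digit_xi j k : dual_digit (xi R p_pr 1 j) k =
  if k == -1 then inord (j %% p) else 0.
Proof.
rewrite /xi big_ord1 expn0 divn1 sub0r.
rewrite -[RHS](dual_digit_rademacherX (-1) (inord (j %% p)) k).
by rewrite inordK// Fp_cast// ltn_mod prime_gt0.
Qed.

Lemma dual_digit_eta M a : dual_digit (eta R p_pr M a) (-1) = 0.
Proof.
rewrite dual_digit_prod big1// => i _.
by rewrite dual_digit_rademacherX.
Qed.
End DualDigits.

(** * The set generated by a tree *)

Section TreeSets.
Set Implicit Arguments. Unset Strict Implicit.
Variables (R : realType) (p : nat) (p_pr : prime p).
Variables (f : 'F_p -> 'F_p) (f0 : f 0 = 0).
Notation X := (character R p).
Notation T := (parent_rel 0 f).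
Notation dig := (@dual_digit R p).

(** The coset of the neutral character fits the same pattern as the edges: it has
    first letter [0], followed by [f 0 = 0]. *)
Lemma tree_setP (chi : X) : tree_set p_pr T chi <->
  dig chi 0 = f (dig chi (-1)) /\ (forall k : int, 1 <= k -> dig chi k = 0).
Proof.
split.
  move=> [/(annihilatorP p_pr) h|[[a b] /= /andP[b0 /eqP fb] /(annih_cosetP p_pr) h]].
    by rewrite !h//; split=> // k k1; apply/h/(le_trans _ k1).
  have e k : -1 <= k -> dig chi k = (if k == -1 then b else 0) + (if k == 0 then a else 0).
    by move=> /h ->; rewrite (dual_digitM p_pr) !dual_digit_rademacherX.
  rewrite !e//= add0r addr0 fb; split=> // k k1; rewrite e; last exact: le_trans k1.
  by rewrite !gt_eqF ?addr0//; exact: lt_le_trans k1.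
move=> [h0 h1].
(* This is the digit expansion of the product of Rademacher powers that
   represents the coset of [chi]. *)
have e k : -1 <= k -> dig chi k =
    (if k == -1 then dig chi (-1) else 0) + (if k == 0 then dig chi 0 else 0).
  have [->|km1] := eqVneq k (-1); first by rewrite addr0.
  have [->|k0] := eqVneq k 0; first by rewrite add0r.
  move=> k1; rewrite addr0 h1//; lia.
have [d0|d0] := eqVneq (dig chi (-1)) 0; [left|right].
  by apply/(annihilatorP p_pr) => k /e ->; rewrite h0 d0 f0 !if_same addr0.
exists (dig chi 0, dig chi (-1)); first by rewrite /= /parent_rel d0 h0 eqxx.
by apply/(annih_cosetP p_pr) => k /e ->; rewrite (dual_digitM p_pr) !dual_digit_rademacherX.
Qed.

(** Multiplying by [pos_shift] changes the digits of index at least 1 arbitrarily,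
    so only the relation between the first two letters survives. *)
Lemma tree_set_periodicP (chi : X) :
  tree_set_periodic p_pr T chi <-> dig chi 0 = f (dig chi (-1)).
Proof.
split=> [[s _ [a _ [psi /tree_setP[h _] <-]]]|h].
  by rewrite !(dual_digitM p_pr) !dual_digit_pos_shift /= !addr0.
have [n /(annihilatorP p_pr) hn] := annihilator_bound p_pr chi.
(* [s] has to be positive even when [n] is zero. *)
pose P := pos_shift R p_pr `|n|.+1 (fun i => dig chi i%:Z).
exists `|n|.+1 => //; exists (fun i => dig chi i%:Z) => //.
exists (chi * P^-1)%g; last by rewrite -mulgA mulVg mulg1.
have e k : dig (chi * P^-1)%g k =
    dig chi k - if 1 <= k <= `|n|.+1%:Z then dig chi `|k|%N else 0.
  by rewrite (dual_digitM p_pr) (dual_digitV p_pr) dual_digit_pos_shift.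
apply/tree_setP; rewrite !e /= !subr0; split=> // k k1.
rewrite e k1 /=; case: leP => kn; last by rewrite subr0 hn//; lia.
by rewrite gez0_abs ?subrr//; lia.
Qed.

Lemma tree_limitP (chi : X) :
  (\bigcap_(n in [set: nat])
     [set char_dil psi n%:Z | psi in tree_set_periodic p_pr T]) chi <->
  (forall n : nat, dig chi n%:Z = f (dig chi (n%:Z - 1))).
Proof.
split=> [h n|h n _].
  have [psi /tree_set_periodicP e <-] := h n I.
  by rewrite !(dual_digit_dil p_pr) subrr e addrAC subrr sub0r.
exists (char_dil chi (- n%:Z)).
  apply/tree_set_periodicP; rewrite !(dual_digit_dil p_pr) opprK add0r addrC; exact: h.
apply: characterP => x /=; congr (chi _).
by apply: vilenkinP => k /=; rewrite subrK.
Qed.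

End TreeSets.

(** * Elementary sets and the refinement equation *)

Section ElementarySet.
Set Implicit Arguments. Unset Strict Implicit.
Variables (R : realType) (p M : nat) (p_pr : prime p).
Variable E : set (character R p).
Notation dig := (@dual_digit R p).

(** The cosets that make up [E] are indexed by their first digit: [xi 1 j] has
    digit [j] at index -1, where [eta] has digit 0. *)
Lemma elementary_section : elementary p_pr 1 M E ->
  exists rep : 'F_p -> character R p,
    (forall d, dig (rep d) (-1) = d) /\
    (forall chi, E chi <->
       forall k : int, -1 <= k -> dig chi k = dig (rep (dig chi (-1))) k).
Proof.
move=> [a [[_ ->] _ _ _]].
pose zeta j := (xi R p_pr 1 j * eta R p_pr M (a j))%g.
have zeta_digit j : (j < p ^ 1)%N -> dig (zeta j) (-1) = inord j.
  rewrite expn1 => jp.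
  by rewrite (dual_digitM p_pr) dual_digit_xi dual_digit_eta addr0 /= modn_small.
have ltp (d : 'F_p) : (d < p ^ 1)%N by rewrite expn1 Fp_ltp.
exists (fun d : 'F_p => zeta d); split.
  by move=> d; rewrite zeta_digit// inord_val.
move=> chi; split=> [[j /= jp /(annih_cosetP p_pr) h] k k1|h].
  rewrite h// h// zeta_digit// inordK ?Fp_cast//.
by exists (dig chi (-1) : nat); [exact: ltp|apply/(annih_cosetP p_pr)].
Qed.

End ElementarySet.

Theorem theorem4p1 (R : realType) (p M : nat) (p_pr : prime p) (p_ge3 : (3 <= p)%N)
    (E : set (character R p)) (phi m0 : character R p -> R[i])
    (E_sub : E `<=` annihilator M%:Z)
    (E_elem : elementary p_pr 1 M E)
    (phi_step : step_space 1 M phi)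
    (phi_norm : forall chi, `|phi chi| = \1_E chi)
    (m0_mask : one_elementary_mask p_pr m0)
    (phi_eq : forall chi, phi chi = m0 chi * phi (char_dil chi (-1))) :
  exists T : rel 'F_p,
    [/\ rooted_tree T, has_height T (M + 2) & tree_generates p_pr T E].
Proof.
have E_shift chi : E chi -> E (char_dil chi (-1)).
  move=> Echi; apply: contrapT => nE.
  have: `|phi (char_dil chi (-1))| = 0 by rewrite phi_norm indicE memNset.
  move/eqP; rewrite normr_eq0 => /eqP phi0; have := phi_norm chi.
  rewrite phi_eq phi0 mulr0 normr0 indicE mem_set// => /eqP.
  by rewrite eq_sym oner_eq0.
have [rep [rep1 EP]] := elementary_section E_elem.
pose f d := dual_digit (rep d) 0.
have Erep d : E (rep d) by apply/EP => k _; rewrite rep1.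
have E_orbit chi (n : nat) : E chi ->
    dual_digit chi (n%:Z - 1) = iter n f (dual_digit chi (-1)).
  elim: n chi => [|n IH] chi Echi; first by rewrite sub0r.
  have -> : n.+1%:Z - 1 = n%:Z - 1 - (-1) by lia.
  rewrite -(dual_digit_dil p_pr) IH; last exact: E_shift.
  by rewrite (dual_digit_dil p_pr) subrr iterSr ((EP chi).1 Echi).
have fM d : iter M.+1 f d = 0.
  rewrite -[d in LHS]rep1 -E_orbit// -[M.+1]addn1 PoszD addrK.
  by have /(annihilatorP p_pr) := E_sub _ (Erep d); apply.
(* [f^(M+2) 0] is [0] when read as [f^(M+1) (f 0)], and [f 0] when read as
   [f (f^(M+1) 0)]. *)
have f0 : f 0 = 0.
  by rewrite -[in RHS](fM (f 0)) -iterSr iterS fM.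
exists (parent_rel 0 f); split.
- exact: parent_rooted_tree fM.
- have [_ [_ _ _ /(_ M)]] := E_elem; rewrite addn1 ltnSn => /(_ isT).
  move=> [chi [[hM nhM] Echi]].
  rewrite addn2; apply: (parent_has_height f0 fM (v := dual_digit chi (-1))).
  apply/eqP; rewrite -E_orbit// => M0; apply: nhM; apply/(annihilatorP p_pr) => // k.
  rewrite le_eqVlt => /predU1P[<-//|Mk]; move/(annihilatorP p_pr): hM; apply.
  by rewrite addrK; move: Mk; lia.
apply/seteqP; split=> chi.
  move=> Echi; apply/(tree_limitP p_pr f0) => n.
  by rewrite E_orbit// -iterS -E_orbit// -[n.+1]addn1 PoszD addrK.
move=> /(tree_limitP p_pr f0) h; apply/EP.
have e (n : nat) : dual_digit chi (n%:Z - 1) = iter n f (dual_digit chi (-1)).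
  by elim: n => [|n IH]; rewrite ?sub0r// iterS -IH -h -[n.+1]addn1 PoszD addrK.
move=> k k1; have -> : k = (absz (k + 1)%R)%:Z - 1 by lia.
by rewrite e E_orbit// rep1.
Qed.
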